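(* The set $\forall\mathrm{FO}$ of universal first-order sentences is superfluous with respect to $\Pi_2^p$: for every vocabulary $\tau$, every second-order sentence $\Psi$ over $\tau$ of the form $\forall\vec R_1\exists\vec R_2\,\varphi$ ($\varphi$ first order) and every universal first-order sentence $\psi$ over $\tau$, if $\mathrm{MOD}[\Psi\wedge\psi]$ is $\Pi_2^p$-complete then $\mathrm{MOD}[\Psi]$ is $\Pi_2^p$-complete.
   Context: Conventions: vocabularies implicitly contain numeric symbols $\le$, BIT, PLUS, TIMES, SUC, $0,1,\max$; finite structures have universe $\{0,\dots,n-1\}$ with standard interpretations; MOD$[\Phi]$ is the set of finite models of $\Phi$; a formula is numeric if it uses only numeric symbols. A universal first-order sentence has the form $\forall x_1\dots\forall x_k\,\theta$ with $\theta$ quantifier-free. $\Pi_2^p$ is the class of problems MOD$[\neg\Phi]$ with $\Phi$ of the form $\exists\vec R_1\forall\vec R_2\,\varphi$, $\varphi$ first order (equivalently, MOD of sentences $\forall\vec R_1\exists\vec R_2\,\varphi$). A first-order projection (fop) from STRUC$[\tau]$ to STRUC$[\sigma]$ ($\sigma=\langle R_1^{a_1},\dots,R_r^{a_r},c_1,\dots,c_s\rangle$) is a tuple $\langle\varphi_0,\varphi_1,\dots,\varphi_r,\psi_1,\dots,\psi_s\rangle$ of first-order $\tau$-formulas mapping $\mathcal A$ to the structure with universe $\{\vec b\in|\mathcal A|^k:\mathcal A\models\varphi_0(\vec b)\}$, $R_i$ defined by $\varphi_i$, $c_j$ the unique tuple satisfying $\psi_j$, where $\varphi_0$ is numeric and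 each $\varphi_i,\psi_j$ has the form $\alpha_0\vee(\alpha_1\wedge\lambda_1)\vee\dots\vee(\alpha_\ell\wedge\lambda_\ell)$ with $\alpha_t$ numeric mutually exclusive and $\lambda_t$ $\tau$-literals. $B$ is $\Pi_2^p$-complete if $B\in\Pi_2^p$ and for every $A\in\Pi_2^p$ there is a fop $I$ with $\mathcal A\in A\iff I(\mathcal A)\in B$. *)

(* Defs.v *)
From mathcomp Require Import all_boot all_order.

Set Implicit Arguments.
Unset Strict Implicit.
Unset Printing Implicit Defensive.

(** * Vocabularies and finite structures *)

(* A finite family of relation symbols with their arities; it is also the type
   of a vector of second-order relation variables. *)
Record rel_block := RelBlock { block_sym :> finType; arity : block_sym -> nat }.

(* Only the non-numeric symbols are listed: the numeric ones are built into the
   syntax of terms and formulas below. *)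
Record vocabulary := Vocabulary { rels : rel_block; consts : finType }.

Definition block_cat (X Y : rel_block) : rel_block :=
  @RelBlock (X + Y)%type
    (fun s => match s with inl R => arity R | inr R => arity R end).

Definition expand (tau : vocabulary) (X : rel_block) : vocabulary :=
  Vocabulary (block_cat (rels tau) X) (consts tau).

Definition block_interp (n : nat) (X : rel_block) : Type :=
  forall R : X, {set (arity R).-tuple 'I_n}.

(* The universe is {0, ..., univ_size - 1}.  It has at least two elements
   because the numeric constant 1 denotes the element 1 of the universe. *)
Record structure (tau : vocabulary) := Structure {
  univ_size : nat;
  univ_size_gt1 : 1 < univ_size;
  rel_interp : block_interp univ_size (rels tau);
  const_interp : consts tau -> 'I_univ_size
}.

Arguments rel_interp {tau} s R.
Arguments const_interp {tau} s c.

Notation univ A := ('I_(univ_size A)).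

Definition zero_elt tau (A : structure tau) : univ A :=
  Ordinal (ltnW (univ_size_gt1 A)).
Definition one_elt tau (A : structure tau) : univ A := Ordinal (univ_size_gt1 A).
Definition max_elt tau (A : structure tau) : univ A := rev_ord (zero_elt A).

Definition expand_structure tau (A : structure tau) (X : rel_block)
    (I : block_interp (univ_size A) X) : structure (expand tau X) :=
  @Structure (expand tau X) (univ_size A) (univ_size_gt1 A)
    (fun s => match s with inl R => rel_interp A R | inr R => I R end)
    (fun c : consts tau => const_interp A c).

(** * First-order logic *)

Section Syntax.
Variable tau : vocabulary.

(* [V] is the type of variables that may occur free; a quantifier binds the
   additional variable [None] of [option V]. *)
Inductive term (V : Type) : Type :=
| Var of V
| Zero
| One
| Max
| Const of consts tau.

Inductive formula (V : Type) : Type :=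
| Eq of term V & term V
| Le of term V & term V
| Bit of term V & term V
| Plus of term V & term V & term V
| Times of term V & term V & term V
| Suc of term V & term V
| Rel (R : rels tau) of (arity R).-tuple (term V)
| Not of formula V
| And of formula V & formula V
| Or of formula V & formula V
| Ex of formula (option V)
| All of formula (option V).

Definition sentence := formula void.

Definition is_numeric_term (V : Type) (t : term V) : bool :=
  if t is Const _ then false else true.

Fixpoint is_numeric (V : Type) (f : formula V) : bool :=
  match f with
  | Eq t u | Le t u | Bit t u | Suc t u =>
      is_numeric_term t && is_numeric_term u
  | Plus t u v | Times t u v =>
      [&& is_numeric_term t, is_numeric_term u & is_numeric_term v]
  | Rel _ _ => false
  | Not g => is_numeric g
  | And g h | Or g h => is_numeric g && is_numeric h
  | Ex g | All g => is_numeric g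
  end.

Definition is_atomic (V : Type) (f : formula V) : bool :=
  match f with
  | Not _ | And _ _ | Or _ _ | Ex _ | All _ => false
  | _ => true
  end.

Definition is_literal (V : Type) (f : formula V) : bool :=
  if f is Not g then is_atomic g else is_atomic f.

Fixpoint is_quantifier_free (V : Type) (f : formula V) : bool :=
  match f with
  | Not g => is_quantifier_free g
  | And g h | Or g h => is_quantifier_free g && is_quantifier_free h
  | Ex _ | All _ => false
  | _ => true
  end.

Fixpoint is_universal (V : Type) (f : formula V) : bool :=
  if f is All g then is_universal g else is_quantifier_free f.

End Syntax.

Arguments Zero {tau V}.
Arguments One {tau V}.
Arguments Max {tau V}.
Arguments Const {tau V} c.

Section Semantics.
Variables (tau : vocabulary) (A : structure tau).

Definition push (V : Type) (x : univ A) (e : V -> univ A) (v : option V) :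
    univ A :=
  if v is Some w then e w else x.

Definition eval (V : Type) (e : V -> univ A) (t : term tau V) : univ A :=
  match t with
  | Var v => e v
  | Zero => zero_elt A
  | One => one_elt A
  | Max => max_elt A
  | Const c => const_interp A c
  end.

(* BIT(i, j): bit j of the binary expansion of i is 1. *)
Fixpoint sat (V : Type) (f : formula tau V) : (V -> univ A) -> bool :=
  match f with
  | Eq t u => fun e => eval e t == eval e u
  | Le t u => fun e => eval e t <= eval e u
  | Bit t u => fun e => odd (eval e t %/ 2 ^ eval e u)
  | Plus t u v => fun e => eval e t + eval e u == eval e v
  | Times t u v => fun e => eval e t * eval e u == eval e v
  | Suc t u => fun e => (eval e t).+1 == eval e u
  | Rel R ts => fun e => [tuple of map (eval e) ts] \in rel_interp A R
  | Not g => fun e => ~~ sat g e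
  | And g h => fun e => sat g e && sat h e
  | Or g h => fun e => sat g e || sat h e
  | Ex g => fun e => [exists x, sat g (push x e)]
  | All g => fun e => [forall x, sat g (push x e)]
  end.

End Semantics.

(** * Second-order sentences *)

Inductive so_sentence (tau : vocabulary) : Type :=
| SOfo of sentence tau
| SOnot of so_sentence tau
| SOand of so_sentence tau & so_sentence tau
| SOex (X : rel_block) of so_sentence (expand tau X)
| SOall (X : rel_block) of so_sentence (expand tau X).

Fixpoint models tau (F : so_sentence tau) : structure tau -> Prop :=
  match F with
  | SOfo f => fun A => sat (A := A) f (of_void (univ A))
  | SOnot G => fun A => ~ models G A
  | SOand G H => fun A => models G A /\ models H A
  | SOex X G => fun A =>
      exists I : block_interp (univ_size A) X, models G (expand_structure I)
  | SOall X G => fun A =>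
      forall I : block_interp (univ_size A) X, models G (expand_structure I)
  end.

Definition problem (tau : vocabulary) := structure tau -> Prop.

Definition MOD tau (F : so_sentence tau) : problem tau := models F.

Definition exists_forall tau (X Y : rel_block)
    (f : sentence (expand (expand tau X) Y)) : so_sentence tau :=
  SOex (SOall (SOfo f)).

Definition forall_exists tau (X Y : rel_block)
    (f : sentence (expand (expand tau X) Y)) : so_sentence tau :=
  SOall (SOex (SOfo f)).

Definition in_Pi2p tau (B : problem tau) : Prop :=
  exists (X Y : rel_block) (f : sentence (expand (expand tau X) Y)),
    forall A, B A <-> MOD (SOnot (exists_forall f)) A.

(** * First-order projections *)

Section Projections.
Variables tau sigma : vocabulary.

Definition projection_formula (V : Type) (a0 : formula tau V)
    (cl : seq (formula tau V * formula tau V)) : formula tau V :=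
  foldl (fun g c => Or g (And c.1 c.2)) a0 cl.

Definition mutually_exclusive (V : Type) (fs : seq (formula tau V)) : Prop :=
  forall (A : structure tau) (e : V -> univ A),
    pairwise (fun f g => ~~ (sat f e && sat g e)) fs.

Definition is_projective (V : Type) (f : formula tau V) : Prop :=
  exists a0 (cl : seq (formula tau V * formula tau V)),
    [/\ f = projection_formula a0 cl,
        all (@is_numeric tau V) (a0 :: map fst cl),
        mutually_exclusive (a0 :: map fst cl)
      & all (@is_literal tau V) (map snd cl)].

(* The variable (i, j) of [fop_rel R] stands for the j-th component of the i-th
   k-tuple of arguments of R. *)
Record fop_data := FopData {
  dim : nat;
  fop_univ : formula tau 'I_dim;
  fop_rel : forall R : rels sigma, formula tau ('I_(arity R) * 'I_dim);
  fop_const : consts sigma -> formula tau 'I_dim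
}.

Variable I : fop_data.

(* The k-tuples are ordered lexicographically, with the first component the
   most significant one. *)
Definition lex_tuple (A : structure tau) : finOrderType _ :=
  (dim I).-tuplelexi (univ A).

Definition image_univ (A : structure tau) : {set lex_tuple A} :=
  [set b | sat (fop_univ I) (tnth b)].

Definition sat_const (A : structure tau) (c : consts sigma) (b : lex_tuple A) :=
  sat (fop_const I c) (tnth b).

(* The second and third conditions say that the image of every structure is
   again a structure. *)
Definition fop_wf : Prop :=
  [/\ is_numeric (fop_univ I)
        /\ (forall R, is_projective (fop_rel I R))
        /\ (forall c, is_projective (fop_const I c)),
      forall A, 1 < #|image_univ A|
    & forall A c, exists! b, b \in image_univ A /\ sat_const c b].

(* The elements of the image universe are renamed 0, ..., m - 1 along the
   lexicographic order by the increasing enumeration [Order.enum_val]. *)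
Definition image_rel (A : structure tau) :
    block_interp #|image_univ A| (rels sigma) :=
  fun R => [set t | sat (fop_rel I R)
    (fun ij => tnth (Order.enum_val (tnth t ij.1) : lex_tuple A) ij.2)].

Hypothesis wf : fop_wf.

Lemma image_univ_gt1 (A : structure tau) : 1 < #|image_univ A|.
Proof. by case: wf. Qed.

(* The default value is never used, by the third condition of [fop_wf]. *)
Definition image_const (A : structure tau) (c : consts sigma) :
    'I_#|image_univ A| :=
  odflt (Ordinal (ltnW (image_univ_gt1 A)))
    [pick i | sat_const c (Order.enum_val i)].

Definition image_structure (A : structure tau) : structure sigma :=
  Structure (image_univ_gt1 A) (@image_rel A) (image_const A).

End Projections.

Record fop (tau sigma : vocabulary) := Fop {
  fop_formulas :> fop_data tau sigma;
  fop_formulasP : fop_wf fop_formulas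
}.

Definition apply_fop tau sigma (I : fop tau sigma) (A : structure tau) :
    structure sigma :=
  image_structure (fop_formulasP I) A.

Definition Pi2p_complete sigma (B : problem sigma) : Prop :=
  in_Pi2p B /\
  forall tau (A : problem tau), in_Pi2p A ->
    exists I : fop tau sigma, forall S, A S <-> B (apply_fop I S).

(* Main.v *)
Require Import Defs.
From mathcomp Require Import all_boot all_order.
From Stdlib Require Import Classical FunctionalExtensionality.

(* Given a problem Q, add to its vocabulary nullary symbols P_i, the flags, with
   more of them than the number k of bits that can matter below, and let Q'
   hold when some flag is up or the reduct is in Q.  Q' is again in Pi_2^p, so
   it reduces to MOD[Psi /\ psi] by some fop I.  Let A' be A with every flag
   down.  If I(A') violated the universal sentence psi, a violation would
   consist of boundedly many elements, atoms and constants of I(A'), and I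
   being a projection each atom or constant depends on at most one bit of A';
   hence on at most k flags, k depending only on psi.  Raising another flag
   keeps the violation but gives a structure in Q', a contradiction.  So
   I(A') satisfies psi for every A, and A in Q iff I(A') satisfies Psi.  Finally
   A |-> I(A') is itself a fop: replace P_i by the literal 0 = 1 in I. *)

Set Implicit Arguments.
Unset Strict Implicit.
Unset Printing Implicit Defensive.

(** * Translations that replace relation atoms by formulas *)

Section Translation.
Variables (sigma1 sigma2 : vocabulary) (tr_const : consts sigma1 -> consts sigma2).
Variable tr_rel : forall (R : rels sigma1) (V : Type),
  (arity R).-tuple (term sigma2 V) -> formula sigma2 V.

Definition tr_term (V : Type) (t : term sigma1 V) : term sigma2 V :=
  match t with
  | Var v => Var _ v
  | Zero => Zero
  | One => One
  | Max => Max
  | Const c => Const (tr_const c)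
  end.

Fixpoint translate (V : Type) (f : formula sigma1 V) : formula sigma2 V :=
  match f with
  | Eq t u => Eq (tr_term t) (tr_term u)
  | Le t u => Le (tr_term t) (tr_term u)
  | Bit t u => Bit (tr_term t) (tr_term u)
  | Plus t u v => Plus (tr_term t) (tr_term u) (tr_term v)
  | Times t u v => Times (tr_term t) (tr_term u) (tr_term v)
  | Suc t u => Suc (tr_term t) (tr_term u)
  | Rel R ts => tr_rel [tuple of map (@tr_term V) ts]
  | Not g => Not (translate g)
  | And g h => And (translate g) (translate h)
  | Or g h => Or (translate g) (translate h)
  | Ex g => Ex (translate g)
  | All g => All (translate g)
  end.

Lemma is_numeric_tr_term (V : Type) (t : term sigma1 V) :
  is_numeric_term (tr_term t) = is_numeric_term t.
Proof. by case: t. Qed.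

Lemma is_numeric_translate (V : Type) (f : formula sigma1 V) :
  is_numeric f -> is_numeric (translate f).
Proof.
elim: V / f => [V t u|V t u|V t u|V t u v|V t u v|V t u|V R ts|V f IH
  |V f IHf g IHg|V f IHf g IHg|V f IH|V f IH] //=;
  by rewrite ?is_numeric_tr_term // => /andP[/IHf -> /IHg ->].
Qed.

Lemma is_literal_translate (V : Type) (f : formula sigma1 V) :
    (forall R (ts : (arity R).-tuple (term sigma2 V)), is_atomic (tr_rel ts)) ->
  is_literal f -> is_literal (translate f).
Proof.
move=> atomic_rel.
have atomic_tr (g : formula sigma1 V) : is_atomic g -> is_atomic (translate g).
  by case: g => //= *; exact: atomic_rel.
case: f => // R ts _.
have /= := atomic_rel _ [tuple of map (@tr_term V) ts].
by rewrite /is_literal /=; case: (tr_rel _).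
Qed.

Lemma translate_projection_formula (V : Type) a0 (cl : seq (formula sigma1 V * formula sigma1 V)) :
  translate (projection_formula a0 cl) =
  projection_formula (translate a0) [seq (translate c.1, translate c.2) | c <- cl].
Proof. by elim: cl a0 => //= c cl IH a0; exact: IH. Qed.

Variables (B : structure sigma2).
Variables (r : block_interp (univ_size B) (rels sigma1)) (c : consts sigma1 -> univ B).
Let A : structure sigma1 := Structure (univ_size_gt1 B) r c.
Hypothesis constE : forall k, const_interp B (tr_const k) = c k.
Hypothesis relE : forall R (V : Type) (ts : (arity R).-tuple (term sigma2 V)) (e : V -> univ B),
  sat (tr_rel ts) e = ([tuple of map (eval e) ts] \in r R).

Lemma eval_tr_term (V : Type) (e : V -> univ B) (t : term sigma1 V) :
  eval e (tr_term t) = eval (A := A) e t.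
Proof. by case: t => //= k; exact: constE. Qed.

Lemma sat_translate (V : Type) (f : formula sigma1 V) (e : V -> univ B) :
  sat (translate f) e = sat (A := A) f e.
Proof.
elim: V / f e => [V t u|V t u|V t u|V t u v|V t u v|V t u|V R ts
  |V f IH|V f IHf g IHg|V f IHf g IHg|V f IH|V f IH] e /=;
  rewrite ?eval_tr_term ?IH ?IHf ?IHg //.
- rewrite relE; set us := [tuple of _]; set vs := [tuple of _].
  suff -> : us = vs by [].
  apply: val_inj; rewrite /= -map_comp.
  by apply: eq_map => t; exact: eval_tr_term.
- exact: (@eq_existsb (univ B) _ _ (fun x => IH (push x e))).
- exact: (@eq_forallb (univ B) _ _ (fun x => IH (push x e))).
Qed.

End Translation.

(** * Images of projections over a prescribed universe *)

Section ImageOn.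
Variables (sigma : vocabulary) (n k : nat).
Implicit Types (U : {set k.-tuplelexi 'I_n}).

(* The image structure of a projection, with its universe made a parameter:
   images with provably equal universes then live on the same type. *)
Definition image_on U (U_gt1 : 1 < #|U|)
    (r : forall R : rels sigma, ('I_(arity R) * 'I_k -> 'I_n) -> bool)
    (c : consts sigma -> k.-tuplelexi 'I_n -> bool) : structure sigma :=
  Structure U_gt1
    (fun R => [set t | r R (fun ij => tnth (Order.enum_val (tnth t ij.1) : k.-tuplelexi 'I_n) ij.2)])
    (fun a => odflt (Ordinal (ltnW U_gt1)) [pick i | c a (Order.enum_val i)]).

Lemma eq_image_on U1 U2 (U1_gt1 : 1 < #|U1|) (U2_gt1 : 1 < #|U2|) r1 r2 c1 c2 :
    U1 = U2 -> (forall R, r1 R =1 r2 R) -> (forall a, c1 a =1 c2 a) ->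
  image_on U1_gt1 r1 c1 = image_on U2_gt1 r2 c2.
Proof.
move=> eqU eqr eqc; case: _ / eqU in U2_gt1 *.
rewrite (bool_irrelevance U2_gt1 U1_gt1); congr Structure.
- by apply: functional_extensionality_dep => R; apply/setP=> t; rewrite !inE eqr.
- apply: functional_extensionality => a; congr odflt.
  by apply: eq_pick => i; exact: eqc.
Qed.

End ImageOn.

Lemma image_structureE tau sigma (I : fop_data tau sigma) (wf : fop_wf I) A :
  image_structure wf A =
  image_on (image_univ_gt1 wf A) (fun R => @sat _ _ _ (fop_rel I R))
    (fun a b => sat_const a b).
Proof. reflexivity. Qed.

(** * Certificates made of few bits *)

Section Stability.
Variable T : finType.

(* At [set0], the value of [F] is certified by at most [k] bits. *)
Definition stable X k (F : {set T} -> X) :=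
  exists2 D : {set T}, #|D| <= k & forall p : {set T}, [disjoint p & D] -> F p = F set0.

Lemma stable_cst X k (F : {set T} -> X) : (forall p, F p = F set0) -> stable k F.
Proof. by move=> eqF; exists set0; rewrite ?cards0. Qed.

Lemma eq_stable X k (F G : {set T} -> X) : F =1 G -> stable k F -> stable k G.
Proof. by move=> eqFG [D leD FD]; exists D => // p; rewrite -!eqFG; exact: FD. Qed.

Lemma stable_mem k x : stable k.+1 (fun p : {set T} => x \in p).
Proof.
exists [set x]; first by rewrite cards1.
by move=> p; rewrite disjoint_sym disjoints1 inE => /negbTE.
Qed.

(** Away from [D] the value of [F] is frozen at [F set0], so [G] needs a certificate only at that
    one value. *)
Lemma stable_bind X Z k l (F : {set T} -> X) (G : X -> {set T} -> Z) :
  stable k F -> stable l (G (F set0)) -> stable (k + l) (fun p => G (F p) p).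
Proof.
move=> [D leD FD] [E leE GE]; exists (D :|: E).
  exact: leq_trans (leq_card_setU D E).1 (leq_add leD leE).
move=> p pDE; rewrite FD ?GE //; apply: disjointWr pDE.
  exact: subsetUr.
exact: subsetUl.
Qed.

Lemma stable_map X Z k (h : X -> Z) (F : {set T} -> X) :
  stable k F -> stable k (fun p => h (F p)).
Proof. by case=> D leD FD; exists D => // p /FD ->. Qed.

Lemma stable_funs (J : finType) X (F : J -> {set T} -> X) :
  (forall j, stable 1 (F j)) -> stable #|J| (fun p j => F j p).
Proof.
move=> stabF.
have /fin_all_exists2[D leD FD] := stabF.
exists (\bigcup_j D j).
  rewrite -[#|J|](@sum1_card J predT).
  apply: (big_ind2 (fun (A : {set T}) m => #|A| <= m)) => [|A m B l leA leB|j _] //.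
    by rewrite cards0.
  exact: leq_trans (leq_card_setU A B).1 (leq_add leA leB).
move=> p /bigcup_disjointP pD; apply: functional_extensionality => j.
by apply: FD; exact: pD.
Qed.

Definition flags : rel_block := @RelBlock T (fun=> 0).

(** A nullary relation is empty or holds of the empty tuple, so each flag is one bit; [p] collects
    the raised ones. *)
Definition with_flags tau (A : structure tau) (p : {set T}) :
    structure (expand tau flags) :=
  expand_structure (A := A) (X := flags) (fun i => [set _ | i \in p]).

End Stability.

(** * Dependence of projective formulas on the flags *)

Section FlaggedProjections.
Variables (T : finType) (tau : vocabulary) (A : structure tau).
Implicit Types (p : {set T}).

Lemma eval_with_flags p (V : Type) (e : V -> univ A) (t : term (expand tau (flags T)) V) :
  eval (A := with_flags A p) e t = eval (A := with_flags A set0) e t.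
Proof. by case: t. Qed.

Lemma sat_numeric_with_flags p (V : Type) (f : formula (expand tau (flags T)) V)
    (e : V -> univ A) :
  is_numeric f ->
  sat (A := with_flags A p) f e = sat (A := with_flags A set0) f e.
Proof.
elim: V / f e => [V t u|V t u|V t u|V t u v|V t u v|V t u|V R ts
  |V f IH|V f IHf g IHg|V f IHf g IHg|V f IH|V f IH] e //=;
  rewrite ?(eval_with_flags p) //.
- by move/IH=> ->.
- by case/andP=> /IHf -> /IHg ->.
- by case/andP=> /IHf -> /IHg ->.
- by move=> num_f; apply: (@eq_existsb (univ A)) => x; exact: IH.
- by move=> num_f; apply: (@eq_forallb (univ A)) => x; exact: IH.
Qed.

Lemma stable_atomic (V : Type) (f : formula (expand tau (flags T)) V) (e : V -> univ A) :
  is_atomic f -> stable 1 (fun p => sat (A := with_flags A p) f e).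
Proof.
case: f => //= [t u|t u|t u|t u v|t u v|t u|[R|i] ts] _.
1-6: by apply: stable_cst => p; rewrite !(eval_with_flags p).
- apply: stable_cst => p /=.
  by rewrite (functional_extensionality _ _ (eval_with_flags p e)).
- by apply: eq_stable (stable_mem 0 i) => p; rewrite inE.
Qed.

Lemma stable_literal (V : Type) (f : formula (expand tau (flags T)) V) (e : V -> univ A) :
  is_literal f -> stable 1 (fun p => sat (A := with_flags A p) f e).
Proof.
case: f => [t u|t u|t u|t u v|t u v|t u|R ts|f|f g|f g|f|f] // lit_f;
  try exact: stable_atomic.
exact: (stable_map negb (stable_atomic e lit_f)).
Qed.

Lemma sat_projection_formula sigma (B : structure sigma) (V : Type) a0
    (cl : seq (formula sigma V * formula sigma V)) (e : V -> univ B) :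
  sat (projection_formula a0 cl) e =
  sat a0 e || has (fun c => sat c.1 e && sat c.2 e) cl.
Proof.
by elim: cl a0 => [|c cl IH] a0 /=; [rewrite orbF | rewrite IH orbA].
Qed.

(* By mutual exclusion at most one of the guards holds, so that at most one
   literal is relevant. *)
Lemma stable_projective (V : Type) (f : formula (expand tau (flags T)) V)
    (e : V -> univ A) :
  is_projective f -> stable 1 (fun p => sat (A := with_flags A p) f e).
Proof.
case=> a0 [cl [-> /= /andP[num_a0 num_cl]]] excl lit_cl.
have {excl} := excl (with_flags A set0) e => /= /andP[_ excl].
apply: (@eq_stable _ _ _ (fun p => sat (A := with_flags A set0) a0 e ||
    has (fun c => sat (A := with_flags A p) c.1 e && sat (A := with_flags A p) c.2 e) cl)).
  by move=> p; rewrite sat_projection_formula -(sat_numeric_with_flags p).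
(* The value of [a0] no longer depends on [p], so only the clauses need a certificate. *)
apply: stable_map.
elim: cl num_cl excl lit_cl => [|[a l] cl IH] /=; first by move=> *; exact: stable_cst.
move=> /andP[num_a num_cl] /andP[excl_a excl] /andP[lit_l lit_cl].
have [sat_a|nsat_a] := boolP (sat (A := with_flags A set0) a e); last first.
  apply: eq_stable (IH num_cl excl lit_cl) => p.
  by rewrite (sat_numeric_with_flags p) // (negbTE nsat_a).
apply: eq_stable (stable_literal e lit_l) => p.
rewrite (sat_numeric_with_flags p e num_a) sat_a /=.
suff -> : has (fun c => sat (A := with_flags A p) c.1 e &&
    sat (A := with_flags A p) c.2 e) cl = false by rewrite orbF.
rewrite {}sat_a /= in excl_a.
elim: cl num_cl excl_a {IH excl lit_cl} => [|[b m] cl IH] //= /andP[num_b num_cl].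
rewrite (sat_numeric_with_flags p e num_b) => /andP[/negbTE -> excl_a].
exact: IH.
Qed.

End FlaggedProjections.

(** * Images of flagged structures and their constants *)

Section FlaggedImages.
Variables (T : finType) (tau sigma : vocabulary) (A : structure tau).
Variable I : fop (expand tau (flags T)) sigma.
Implicit Types (p : {set T}).

Lemma image_univ_with_flags p :
  image_univ I (with_flags A p) = image_univ I (with_flags A set0).
Proof.
have [[num_univ _] _ _] := fop_formulasP I.
by apply/setP=> b; rewrite !inE; exact: sat_numeric_with_flags.
Qed.

(** The universe formula is numeric, so raising flags does not change the universe. Built on the one
    with all flags down, the images share elements and assignments. *)
Definition flagged_image p : structure sigma :=
  image_on (image_univ_gt1 (fop_formulasP I) (with_flags A set0))
    (fun R => sat (A := with_flags A p) (fop_rel I R))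
    (fun a b => sat_const (A := with_flags A p) a b).

Lemma flagged_imageE p : apply_fop I (with_flags A p) = flagged_image p.
Proof.
rewrite /apply_fop image_structureE; apply: eq_image_on => //.
exact: image_univ_with_flags.
Qed.

Lemma const_flagged_image p a (i : univ (flagged_image p)) :
  sat_const (A := with_flags A p) a (Order.enum_val i) ->
  const_interp (flagged_image p) a = i.
Proof.
have [_ _ /(_ (with_flags A p) a) [b [_ b_uniq]]] := fop_formulasP I.
have unique_i j : sat_const (A := with_flags A p) a (Order.enum_val j) ->
    b = Order.enum_val (j : univ (flagged_image p)).
  move=> sat_j; apply: b_uniq; split=> //.
  by rewrite image_univ_with_flags; exact: Order.enum_valP.
move=> sat_i /=; case: pickP => [j sat_j | /(_ i)]; last by rewrite sat_i.
by apply: Order.enum_val_inj; rewrite -(unique_i _ sat_i) (unique_i _ sat_j).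
Qed.

(** At the tuple denoting the constant for [set0], one flag certifies the defining formula. While
    that formula holds there, uniqueness keeps the constant in place, and no other tuple need be
    inspected. *)
Lemma stable_const_flagged_image a :
  stable (X := univ (flagged_image set0)) 1
    (fun p => const_interp (flagged_image p) a).
Proof.
have [[_ [_ proj_const]] _ /(_ (with_flags A set0) a) [b [[b_in sat_b] _]]] :=
  fop_formulasP I.
pose i := Order.enum_rank_in b_in b.
have iE : Order.enum_val i = b by exact: Order.enum_rankK_in.
have [D leD FD] := stable_projective (A := A) (tnth b) (proj_const a).
exists D => // p /FD sat_p.
rewrite !(@const_flagged_image _ _ i) // iE //.
exact: etrans sat_p sat_b.
Qed.

Lemma stable_consts_flagged_image :
  stable (X := consts sigma -> univ (flagged_image set0)) #|consts sigma|
    (fun p => const_interp (flagged_image p)).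
Proof. exact: stable_funs stable_const_flagged_image. Qed.

End FlaggedImages.

(* The constants are recharged at every atom. *)
Fixpoint bit_cost sigma (V : Type) (f : formula sigma V) : nat :=
  match f with
  | Rel _ _ => #|consts sigma| + 1
  | Not g | Ex g | All g => bit_cost g
  | And g h | Or g h => bit_cost g + bit_cost h
  | _ => #|consts sigma|
  end.

(** * First-order truth in flagged images *)

Section FlaggedSat.
Variables (T : finType) (tau sigma : vocabulary) (A : structure tau).
Variable I : fop (expand tau (flags T)) sigma.
Implicit Types (p : {set T}).
Let img := flagged_image A I.

(** The certified value is the whole evaluation function, so one certificate for the constants
    serves all terms of an atom. *)
Lemma stable_eval_flagged_image (V : Type) (e : V -> univ (img set0)) :
  stable (X := term sigma V -> univ (img set0)) #|consts sigma|
    (fun p => eval (A := img p) e).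
Proof.
have [D leD constD] := stable_consts_flagged_image A I.
exists D => // p /constD eq_const; apply: functional_extensionality => t.
by case: t => //= c; exact: (congr1 (fun h => h c) eq_const).
Qed.

Lemma stable_sat_flagged_image (V : Type) (f : formula sigma V)
    (e : V -> univ (img set0)) :
  is_quantifier_free f -> stable (bit_cost f) (fun p => sat (A := img p) f e).
Proof.
elim: V / f e => [V t u|V t u|V t u|V t u v|V t u v|V t u|V R ts
  |V f IH|V f IHf g IHg|V f IHf g IHg|V f IH|V f IH] e //= qf_f.
1-6: by have [D leD evalD] := stable_eval_flagged_image e;
  exists D => // p /evalD ->.
- have [[_ [/(_ R) proj_R _]] _ _] := fop_formulasP I.
  (* Freezing the arguments costs the constants; for fixed arguments the projective formula of [R]
     adds one bit. *)
  pose G (ev : term sigma V -> univ (img set0)) p :=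
    sat (A := with_flags A p) (fop_rel I R) (fun ij => tnth
      (Order.enum_val (tnth [tuple of map ev ts] ij.1) : lex_tuple I (with_flags A set0))
      ij.2).
  have stabG : stable 1 (G (eval (A := img set0) e)) by exact: stable_projective.
  apply: eq_stable (stable_bind (stable_eval_flagged_image e) stabG) => p.
  by rewrite inE.
- exact: (stable_map negb (IH e qf_f)).
- case/andP: qf_f => qf_f qf_g.
  exact: (stable_bind (G := fun b p => b && sat (A := img p) g e)
    (IHf e qf_f) (stable_map (andb _) (IHg e qf_g))).
- case/andP: qf_f => qf_f qf_g.
  exact: (stable_bind (G := fun b p => b || sat (A := img p) g e)
    (IHf e qf_f) (stable_map (orb _) (IHg e qf_g))).
Qed.

(** The elements of a counterexample at [set0] lie in every image, as the universe is shared; only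
    the failure of the matrix at them needs a certificate. *)
Lemma unsat_universal_flagged_image (V : Type) (f : formula sigma V)
    (e : V -> univ (img set0)) :
  is_universal f -> ~~ sat (A := img set0) f e ->
  exists2 D : {set T}, #|D| <= bit_cost f &
    forall p : {set T}, [disjoint p & D] -> ~~ sat (A := img p) f e.
Proof.
have qf_case W (g : formula sigma W) e' : is_quantifier_free g ->
    ~~ sat (A := img set0) g e' ->
    exists2 D : {set T}, #|D| <= bit_cost g &
      forall p : {set T}, [disjoint p & D] -> ~~ sat (A := img p) g e'.
  move=> qf_g unsat_g; have [D leD satD] := stable_sat_flagged_image e' qf_g.
  by exists D => // p /satD ->.
elim: V / f e => [V t u|V t u|V t u|V t u v|V t u v|V t u|V R ts
  |V f IH|V f IHf g IHg|V f IHf g IHg|V f IH|V f IH] e; try exact: qf_case.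
move=> univ_f /forallPn[x unsat_f].
have [D leD unsatD] := IH (push (A := img set0) x e) univ_f unsat_f.
by exists D => // p /unsatD unsat_p; apply/forallPn; exists x; exact: unsat_p.
Qed.

(* A violation is witnessed by too few flags to survive raising any single
   flag. *)
Lemma universal_flagged_image (f : sentence sigma) :
    is_universal f -> bit_cost f < #|T| ->
    (forall i, sat (A := img [set i]) f (of_void _)) ->
  sat (A := img set0) f (of_void _).
Proof.
move=> univ_f ltT sat_f; apply: contraT => /(unsat_universal_flagged_image univ_f).
case=> D leD unsatD.
have [i iD] : exists i, i \notin D.
  apply/existsP; rewrite -negb_forall; apply: contraL ltT => /forallP allD.
  by rewrite -leqNgt (leq_trans _ leD) // subset_leq_card //; apply/subsetP.
by move: (unsatD [set i]); rewrite disjoints1 iD sat_f => /(_ isT).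
Qed.

End FlaggedSat.

(** * Eliminating the flags from a projection *)

Section DropFlags.
Variables (T : finType) (tau : vocabulary).

(** [Eq Zero One] is false because structures have at least two elements; being atomic, it keeps
    literals literals. *)
Definition drop_flags_rel (R : rels (expand tau (flags T))) :
    forall V : Type, (arity R).-tuple (term tau V) -> formula tau V :=
  match R with
  | inl R => fun V ts => @Rel tau V R ts
  | inr _ => fun V _ => Eq Zero One
  end.

Definition drop_flags (V : Type) (f : formula (expand tau (flags T)) V) :
    formula tau V :=
  translate (sigma1 := expand tau (flags T)) (sigma2 := tau) id drop_flags_rel f.

Lemma sat_drop_flags (A : structure tau) (V : Type)
    (f : formula (expand tau (flags T)) V) (e : V -> univ A) :
  sat (drop_flags f) e = sat (A := with_flags A set0) f e.
Proof. by apply: sat_translate => // -[R|i] V' ts e' //=; rewrite !inE. Qed.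

Lemma is_projective_drop_flags (V : Type) (f : formula (expand tau (flags T)) V) :
  is_projective f -> is_projective (drop_flags f).
Proof.
case=> a0 [cl [-> num excl lit]].
have fstE : drop_flags a0 :: map fst [seq (drop_flags c.1, drop_flags c.2) | c <- cl]
    = map (@drop_flags V) (a0 :: map fst cl).
  by rewrite /= -!map_comp.
exists (drop_flags a0), [seq (drop_flags c.1, drop_flags c.2) | c <- cl].
split; rewrite ?fstE.
- exact: translate_projection_formula.
- by rewrite all_map; apply: sub_all num => g; exact: is_numeric_translate.
(* Translated guards exclude each other in [A] because the original ones do in
   [with_flags A set0]. *)
- move=> A e; rewrite pairwise_map; apply: sub_pairwise (excl (with_flags A set0) e).
  by move=> g h /=; rewrite !sat_drop_flags.
- rewrite -map_comp all_map; rewrite all_map in lit; apply: sub_all lit => c /=.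
  by apply: is_literal_translate => -[].
Qed.

Variables (sigma : vocabulary) (I : fop (expand tau (flags T)) sigma).

Definition drop_flags_data : fop_data tau sigma :=
  FopData (drop_flags (fop_univ I)) (fun R => drop_flags (fop_rel I R))
    (fun a => drop_flags (fop_const I a)).

Lemma image_univ_drop_flags A :
  image_univ drop_flags_data A = image_univ I (with_flags A set0).
Proof. by apply/setP=> b; rewrite !inE; exact: sat_drop_flags. Qed.

Lemma drop_flags_wf : fop_wf drop_flags_data.
Proof.
have [[num_univ [proj_rel proj_const]] card_univ uniq_const] := fop_formulasP I.
split.
- split; first exact: is_numeric_translate.
  by split=> [R|a]; exact: is_projective_drop_flags.
- by move=> A; have := card_univ (with_flags A set0); rewrite -image_univ_drop_flags.
- move=> A a; rewrite image_univ_drop_flags.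
  have [b [[b_in sat_b] b_uniq]] := uniq_const (with_flags A set0) a.
  exists b; split; first by split=> //; rewrite /sat_const sat_drop_flags.
  move=> b' [b'_in]; rewrite /sat_const sat_drop_flags => sat_b'.
  exact: b_uniq.
Qed.

Definition drop_flags_fop : fop tau sigma := Fop drop_flags_wf.

Lemma apply_drop_flags_fop A : apply_fop drop_flags_fop A = flagged_image A I set0.
Proof.
rewrite /apply_fop image_structureE; apply: eq_image_on.
- exact: image_univ_drop_flags.
- by move=> R ij; exact: sat_drop_flags.
- by move=> a b; exact: sat_drop_flags.
Qed.

End DropFlags.

(** * Adding flags below the second-order blocks *)

Section FlaggedProblem.
Variables (T : finType) (tau : vocabulary) (X Y : rel_block).

Let sigma1 := expand (expand tau X) Y.
Let sigma2 := expand (expand (expand tau (flags T)) X) Y.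

Definition insert_flags_rel (R : rels sigma1) :
    forall V : Type, (arity R).-tuple (term sigma2 V) -> formula sigma2 V :=
  match R with
  | inl (inl R) => fun V ts => @Rel sigma2 V (inl (inl (inl R))) ts
  | inl (inr R) => fun V ts => @Rel sigma2 V (inl (inr R)) ts
  | inr R => fun V ts => @Rel sigma2 V (inr R) ts
  end.

Definition insert_flags (V : Type) (f : formula sigma1 V) : formula sigma2 V :=
  translate (sigma1 := sigma1) (sigma2 := sigma2) id insert_flags_rel f.

Definition flag_down (V : Type) (i : T) : formula sigma2 V :=
  Not (@Rel sigma2 V (inl (inl (inr i))) [tuple]).

(** [Not (Eq Zero One)] stands for truth, the empty conjunction. *)
Definition no_flag (V : Type) : formula sigma2 V :=
  foldr (fun i f => And (flag_down V i) f) (Not (Eq Zero One)) (enum T).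

Variables (A : structure tau) (p : {set T}).
Variables (J : block_interp (univ_size A) X) (K : block_interp (univ_size A) Y).
Let A1 := expand_structure (A := expand_structure (A := A) J) K.
Let A2 := expand_structure (A := expand_structure (A := with_flags A p) J) K.

Lemma sat_no_flag (V : Type) (e : V -> univ A) : sat (A := A2) (no_flag V) e = (p == set0).
Proof.
rewrite /no_flag; set s := enum T.
have -> : (p == set0) = all (fun i => i \notin p) s.
  apply/eqP/allP => [-> i | p0]; first by rewrite inE.
  by apply/setP=> i; rewrite inE; apply/negbTE/p0; rewrite mem_enum.
by elim: s => //= i s ->; rewrite inE.
Qed.

Lemma sat_insert_flags (V : Type) (f : formula sigma1 V) (e : V -> univ A) :
  sat (A := A2) (insert_flags f) e =
  sat (A := A1) f e.
Proof. by apply: sat_translate => // -[[R|R]|R] V' ts e'. Qed.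

End FlaggedProblem.

(** * Membership and hardness *)

Lemma in_Pi2p_forall_exists tau (X Y : rel_block)
    (phi : sentence (expand (expand tau X) Y)) :
  in_Pi2p (MOD (forall_exists phi)).
Proof.
(* The class is presented by negated exists-forall sentences, so the matrix is negated; the converse
   uses classical logic to obtain the inner witness. *)
exists X, Y, (Not phi) => A; split=> [sat_phi [J unsat] | sat_phi J].
  by have [K sat_K] := sat_phi J; have /negP := unsat K.
apply: NNPP => unsat; apply: sat_phi; exists J => K /=.
by apply/negP => sat_K; apply: unsat; exists K.
Qed.

Theorem theorem6 (tau : vocabulary) (X Y : rel_block)
    (phi : sentence (expand (expand tau X) Y)) (psi : sentence tau) :
  is_universal psi ->
  Pi2p_complete (MOD (SOand (forall_exists phi) (SOfo psi))) ->
  Pi2p_complete (MOD (forall_exists phi)).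
Proof.
move=> univ_psi [_ hard]; split; first exact: in_Pi2p_forall_exists.
move=> tau0 Q [X0 [Y0 [f Q_f]]].
(* One flag more than a violation of [psi] can depend on. *)
pose T : finType := 'I_(bit_cost psi).+1.
(* Under the negation in [Q'], the conjunct [no_flag] makes the problem true once a flag is up and
   leaves [Q] otherwise. *)
pose f' := And (no_flag T tau0 X0 Y0 void) (insert_flags T f).
pose Q' : problem (expand tau0 (flags T)) := MOD (SOnot (exists_forall f')).
have Q'_0 S : Q' (with_flags S set0) <-> Q S.
  split.
    move=> Q'S; apply/Q_f => -[J sat_J]; apply: Q'S; exists J => K.
    apply/andP; split; first exact: (etrans (@sat_no_flag T tau0 X0 Y0 S set0 J K _ _) (eqxx _)).
    exact: (etrans (@sat_insert_flags T tau0 X0 Y0 S set0 J K _ _ _) (sat_J K)).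
  move=> /Q_f QS [J sat_J]; apply: QS; exists J => K.
  have /andP[_ sat_K] := sat_J K.
  exact: (etrans (esym (@sat_insert_flags T tau0 X0 Y0 S set0 J K _ _ _)) sat_K).
have Q'_1 S i : Q' (with_flags S [set i]).
  (* Any value for the second block would do, as [no_flag] does not mention it. *)
  move=> [J sat_J]; have /andP[down _] := sat_J (fun=> set0).
  have /eqP/setP/(_ i) := etrans (esym (@sat_no_flag T tau0 X0 Y0 S [set i] J (fun=> set0) _ _)) down.
  by rewrite !inE eqxx.
have [|I Q'_I] := hard _ Q'; first by exists X0, Y0, f'.
(* Raising any single flag gives a yes-instance of [Q'], whose image satisfies [psi]; hence so does
   the image with all flags down. *)
have sat_psi S : sat (A := flagged_image S I set0) psi (of_void _).
  apply: universal_flagged_image => // [|i]; first by rewrite card_ord.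
  by have /Q'_I := Q'_1 S i; rewrite flagged_imageE => -[].
exists (drop_flags_fop I) => S; rewrite apply_drop_flags_fop.
apply: iff_trans (iff_sym (Q'_0 S)) (iff_trans (Q'_I _) _).
by rewrite flagged_imageE; split=> [[] | sat_phi] //; split=> //; exact: sat_psi.
Qed.
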